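(* Let $n,d\ge 1$ be integers, let $\bar\gamma=(\gamma_1,\dots,\gamma_n)$ where each $\gamma_i$ is a directional function on $\mathbb{S}^{d-1}$, and let $A=[a_{ij}]\in\mathbb{R}^{n\times n}$ be a nonnegative weight matrix for a strongly connected directed graph $\mathcal{G}(n)$ on the nodes $\{1,\dots,n\}$, satisfying $$a_{ii}\min_{x\in\mathbb{S}^{d-1}}\gamma_i(x)>\sum_{j\ne i}a_{ij}\max_{x\in\mathbb{S}^{d-1}}\gamma_j(x)\qquad\forall i\in\{1,\dots,n\}.$$ For $X_0\in\mathbb{S}(n,d,\bar\gamma)$ and an integer $t_0\ge0$ let $X(t)$, $t\ge t_0$, be given by $X(t_0)=X_0$ and $X(t+1)=P_{\mathbb{S}(n,d,\bar\gamma)}(AX(t))$, with $x_i(t)=[X(t)]_i$. Let $\mathcal{U}$ be the set of $X_0\in\mathbb{S}(n,d,\bar\gamma)$ for which there is asymptotic consensus of directions with point-wise convergence, i.e. for which there exists $u=u(X_0)\in\mathbb{S}^{d-1}$ with $\left\|\frac{x_i(t)}{\|x_i(t)\|_2}-u\right\|_2\to0$ as $t\to\infty$ for all $i$. Then: (1) $\mathcal{U}$ is an open subset of $\mathbb{S}(n,d,\bar\gamma)$; (2) the consensus direction $u(X_0)$ is continuous in $X_0$ at every point of $\mathcal{U}$ (and likewise, when $\gamma_1=\dots=\gamma_n$, the consensus state, i.e. the common limit of the $x_i(t)$ as $t\to\infty$, is continuous in $X_0$ at every point of $\mathcal{U}$).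
   Context: Vectors are row vectors; $[X]_i$ is the $i$-th row of a matrix $X$. $\mathbb{S}^{d-1}=\{x\in\mathbb{R}^d:\|x\|_2=1\}$. Nonnegative weight matrix: $A=[a_{ij}]\in\mathbb{R}^{n\times n}$ is a nonnegative weight matrix for a directed graph with nodes $\{1,\dots,n\}$ and edge set $\mathcal{E}$ if $a_{ij}>0$ for $(i,j)\in\mathcal{E}$ and $a_{ij}=0$ for $(i,j)\notin\mathcal{E}$ (self-loops are allowed). A directional function on $\mathbb{S}^{d-1}$ is a continuous function $\gamma:\mathbb{S}^{d-1}\to\mathbb{R}^+$ bounded above and below by positive constants. Its star boundary is $\mathbb{S}^{d-1}_\gamma=\{\gamma(x)x:x\in\mathbb{S}^{d-1}\}$. For $\bar\gamma=(\gamma_1,\dots,\gamma_n)$, $\mathbb{S}(n,d,\bar\gamma)=\{X\in\mathbb{R}^{n\times d}:[X]_i\in\mathbb{S}^{d-1}_{\gamma_i}\ \forall i\}$, with the subspace topology from $\mathbb{R}^{n\times d}$. Row-wise radial projection: for $X\in\mathbb{R}^{n\times d}$ with no zero rows, $P_{\mathbb{S}(n,d,\bar\gamma)}(X)$ is the $n\times d$ matrix whose $i$-th row is $\gamma_i\!\left(\frac{[X]_i}{\|[X]_i\|_2}\right)\frac{[X]_i}{\|[X]_i\|_2}$. (Under the stated inequality on $A$ and $\bar\gamma$, $AX$ has no zero rows for any $X\in\mathbb{S}(n,d,\bar\gamma)$, so the iteration is well defined.) *)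

(* Defs.v *)
From mathcomp Require Import all_boot all_order all_algebra.
From mathcomp Require Import all_classical all_reals all_analysis.

Import Order.TTheory GRing.Theory Num.Theory.
Import numFieldNormedType.Exports.

Local Open Scope classical_set_scope.
Local Open Scope ring_scope.

(* The library norm `|x| on 'rV[R]_d is the maximum norm. *)
Definition norm2 {R : realType} {d : nat} (x : 'rV[R]_d) : R :=
  Num.sqrt (\sum_(j < d) x 0 j ^+ 2).

Definition sphere2 {R : realType} (d : nat) : set 'rV[R]_d :=
  [set x | norm2 x = 1].

Definition unitdir {R : realType} {d : nat} (x : 'rV[R]_d) : 'rV[R]_d :=
  (norm2 x)^-1 *: x.

(* Functions on the sphere are represented by functions on 'rV[R]_d of which
   only the values on the sphere are ever constrained. *)
Definition directional {R : realType} {d : nat} (g : 'rV[R]_d -> R) : Prop :=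
  {within sphere2 d, continuous g} /\
  exists a b : R, [/\ 0 < a, 0 < b &
    forall x, sphere2 d x -> a <= g x <= b].

Definition star_boundary {R : realType} {d : nat} (g : 'rV[R]_d -> R) :
    set 'rV[R]_d :=
  [set g x *: x | x in sphere2 d].

Definition star_product {R : realType} {n d : nat}
    (gamma : 'I_n -> 'rV[R]_d -> R) : set 'M[R]_(n, d) :=
  [set X | forall i, star_boundary (gamma i) (row i X)].

Definition radial_proj {R : realType} {n d : nat}
    (gamma : 'I_n -> 'rV[R]_d -> R) (X : 'M[R]_(n, d)) : 'M[R]_(n, d) :=
  \matrix_i (gamma i (unitdir (row i X)) *: unitdir (row i X)).

Definition weight_matrix {R : realType} {n : nat} (E : rel 'I_n)
    (A : 'M[R]_n) : Prop :=
  forall i j, (E i j -> 0 < A i j) /\ (~~ E i j -> A i j = 0).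

Definition strongly_connected {n : nat} (E : rel 'I_n) : Prop :=
  forall i j, connect E i j.

(* Meaningful when the minimum (maximum) of the set is attained, as for the
   image of the sphere under a directional function when d >= 1. *)
Definition set_min {R : realType} (A : set R) : R := get (A `&` lbound A).
Definition set_max {R : realType} (A : set R) : R := get (A `&` ubound A).

(* X(t) for t >= t0; for t < t0 the value is X0 and plays no role. *)
Definition trajectory {R : realType} {n d : nat} (A : 'M[R]_n)
    (gamma : 'I_n -> 'rV[R]_d -> R) (t0 : nat) (X0 : 'M[R]_(n, d))
    (t : nat) : 'M[R]_(n, d) :=
  iter (t - t0) (fun X => radial_proj gamma (A *m X)) X0.

Definition is_consensus_direction {R : realType} {n d : nat} (A : 'M[R]_n)
    (gamma : 'I_n -> 'rV[R]_d -> R) (t0 : nat) (X0 : 'M[R]_(n, d))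
    (u : 'rV[R]_d) : Prop :=
  sphere2 d u /\
  forall i : 'I_n,
    norm2 (unitdir (row i (trajectory A gamma t0 X0 t)) - u) @[t --> \oo]
      --> (0 : R).

Definition consensus_set {R : realType} {n d : nat} (A : 'M[R]_n)
    (gamma : 'I_n -> 'rV[R]_d -> R) (t0 : nat) : set 'M[R]_(n, d) :=
  [set X0 | star_product gamma X0 /\
            exists u, is_consensus_direction A gamma t0 X0 u].

Definition consensus_direction {R : realType} {n d : nat} (A : 'M[R]_n)
    (gamma : 'I_n -> 'rV[R]_d -> R) (t0 : nat) (X0 : 'M[R]_(n, d)) :
    'rV[R]_d :=
  get (is_consensus_direction A gamma t0 X0).

Definition is_consensus_state {R : realType} {n d : nat} (A : 'M[R]_n)
    (gamma : 'I_n -> 'rV[R]_d -> R) (t0 : nat) (X0 : 'M[R]_(n, d))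
    (y : 'rV[R]_d) : Prop :=
  forall i : 'I_n, row i (trajectory A gamma t0 X0 t) @[t --> \oo] --> y.

Definition consensus_state {R : realType} {n d : nat} (A : 'M[R]_n)
    (gamma : 'I_n -> 'rV[R]_d -> R) (t0 : nat) (X0 : 'M[R]_(n, d)) :
    'rV[R]_d :=
  get (is_consensus_state A gamma t0 X0).

(* Main.v *)
(* Near consensus all directions lie in a cap [c |x| <= <x, u>], a convex cone
   that the iteration preserves.  Projecting the rows centrally onto the
   hyperplane [<x, u> = 1] turns the iteration into an averaging with
   stochastic weights, bounded below along the edges and the self-loops (the
   dominance inequality makes every [a_ii] positive), so strong connectivity
   forces the projected rows to a common limit, which stays in the cap.
   A consensus trajectory enters an arbitrarily narrow cap around its limit in
   finite time; since finitely many steps are continuous, so do all the nearby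
   trajectories, which gives both openness and continuity. *)
Require Import Defs.
From mathcomp Require Import all_boot all_order all_algebra.
From mathcomp Require Import all_classical all_reals all_analysis.
From mathcomp Require Import ring lra.
Import Order.TTheory GRing.Theory Num.Theory.
Import numFieldNormedType.Exports.
Local Open Scope classical_set_scope.
Local Open Scope ring_scope.

(** * Euclidean inner product, norm and directions of row vectors *)

Definition dot {R : realType} {d : nat} (x y : 'rV[R]_d) : R :=
  \sum_(j < d) x 0 j * y 0 j.

Section Euclidean.
Context {R : realType} {d : nat}.
Implicit Types x y u v : 'rV[R]_d.

Lemma dotDl x y u : dot (x + y) u = dot x u + dot y u.
Proof.
by rewrite /dot -big_split; apply: eq_bigr => j _; rewrite mxE mulrDl.
Qed.

Lemma dotZl a x u : dot (a *: x) u = a * dot x u.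
Proof. by rewrite /dot mulr_sumr; apply: eq_bigr => j _; rewrite mxE mulrA. Qed.

Lemma dotC x y : dot x y = dot y x.
Proof. by apply: eq_bigr => j _; rewrite mulrC. Qed.

Lemma dot_suml (I : finType) (F : I -> 'rV[R]_d) u :
  dot (\sum_i F i) u = \sum_i dot (F i) u.
Proof.
apply: (big_morph (fun x => dot x u) (fun x y => dotDl x y u)).
by rewrite /dot big1 // => j _; rewrite mxE mul0r.
Qed.

Lemma dotxx_ge0 x : 0 <= dot x x.
Proof. by apply: sumr_ge0 => j _; rewrite -expr2 sqr_ge0. Qed.

Lemma norm2_ge0 x : 0 <= norm2 x.
Proof. exact: sqrtr_ge0. Qed.

Lemma norm2_sqr x : norm2 x ^+ 2 = dot x x.
Proof.
by rewrite /norm2 sqr_sqrtr ?sumr_ge0// => j _; rewrite sqr_ge0.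
Qed.

Lemma norm2_eq0 x : norm2 x = 0 -> x = 0.
Proof.
move=> x0; have := norm2_sqr x; rewrite x0 expr0n /= => /esym/eqP.
rewrite psumr_eq0 => [/allP x00|j _]; last by rewrite -expr2 sqr_ge0.
apply/rowP => j; rewrite mxE; apply/eqP.
by have := x00 j (mem_index_enum j); rewrite mulf_eq0 orbb.
Qed.

Lemma norm20 : norm2 (0 : 'rV[R]_d) = 0.
Proof.
by rewrite /norm2 big1 ?sqrtr0// => j _; rewrite mxE expr0n.
Qed.

Lemma norm2Z a x : norm2 (a *: x) = `|a| * norm2 x.
Proof.
rewrite -sqrtr_sqr -sqrtrM ?sqr_ge0// mulr_sumr; congr Num.sqrt.
by apply: eq_bigr => j _; rewrite mxE exprMn.
Qed.

Lemma norm2_neq0 x : x != 0 -> 0 < norm2 x.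
Proof.
move=> x0; rewrite lt_neqAle norm2_ge0 andbT eq_sym.
by apply: contra x0 => /eqP/norm2_eq0 ->.
Qed.

(** Cauchy-Schwarz: for nonzero vectors, the squared norm of [norm2 y *: x - norm2 x *: y] is
    [2 * norm2 x * norm2 y] times the difference of the two sides. *)
Lemma dot_le_norm2 x y : dot x y <= norm2 x * norm2 y.
Proof.
have [->|x0] := eqVneq x 0.
  by rewrite norm20 mul0r /dot big1// => j _; rewrite mxE mul0r.
have [->|y0] := eqVneq y 0.
  by rewrite norm20 mulr0 /dot big1// => j _; rewrite mxE mulr0.
have nx := norm2_neq0 x x0; have ny := norm2_neq0 y y0.
have := dotxx_ge0 (norm2 y *: x + (- norm2 x) *: y).
rewrite dotDl !(dotC _ (_ + _)) !dotDl !dotZl !(dotC _ (_ *: _)) !dotZl.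
rewrite -!norm2_sqr (dotC y x) => h.
have : 0 <= (2 * (norm2 x * norm2 y)) * (norm2 x * norm2 y - dot x y) by lra.
by rewrite pmulr_rge0 ?subr_ge0// mulr_gt0// mulr_gt0.
Qed.

Lemma norm2D x y : norm2 (x + y) <= norm2 x + norm2 y.
Proof.
have h : norm2 (x + y) ^+ 2 <= (norm2 x + norm2 y) ^+ 2.
  rewrite norm2_sqr dotDl !(dotC _ (_ + _)) !dotDl -!norm2_sqr.
  have := dot_le_norm2 x y; rewrite (dotC y x); lra.
by rewrite -ler_sqr ?nnegrE ?addr_ge0 ?norm2_ge0.
Qed.

Lemma norm2_sum (I : finType) (P : pred I) (F : I -> 'rV[R]_d) :
  norm2 (\sum_(i | P i) F i) <= \sum_(i | P i) norm2 (F i).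
Proof.
elim/big_rec2: _ => [|i a v _ h]; first by rewrite norm20.
by rewrite (le_trans (norm2D _ _))// lerD2l.
Qed.

Lemma norm2N x : norm2 (- x) = norm2 x.
Proof. by rewrite -scaleN1r norm2Z normrN1 mul1r. Qed.

Lemma normr_coord_le x j : `|x 0 j| <= norm2 x.
Proof.
rewrite -sqrtr_sqr ler_wsqrtr// (bigD1 j)//= lerDl sumr_ge0// => k _.
by rewrite sqr_ge0.
Qed.

Lemma norm2_unitdir x : x != 0 -> norm2 (unitdir x) = 1.
Proof.
move=> /norm2_neq0 x0; rewrite norm2Z gtr0_norm ?invr_gt0// mulVf//.
by rewrite gt_eqF.
Qed.

Lemma unitdirZ a x : 0 < a -> unitdir (a *: x) = unitdir x.
Proof.
move=> a0; rewrite /unitdir norm2Z gtr0_norm// invfM scalerA.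
by rewrite -mulrA (mulrC _ a) mulrA mulVf ?mul1r// gt_eqF.
Qed.

Lemma unitdir_id x : norm2 x = 1 -> unitdir x = x.
Proof. by move=> x1; rewrite /unitdir x1 invr1 scale1r. Qed.

Lemma sphere2_neq0 x : sphere2 d x -> x != 0.
Proof.
by move=> x1; apply: contra_eqN x1 => /eqP ->; rewrite norm20 eq_sym oner_eq0.
Qed.

(** Converts a lower bound on the cosine [dot x u] into an upper bound on the distance. *)
Lemma norm2_sub_sqr x u : norm2 x = 1 -> norm2 u = 1 ->
  norm2 (x - u) ^+ 2 = 2 - 2 * dot x u.
Proof.
move=> x1 u1; rewrite norm2_sqr -scaleN1r dotDl !(dotC _ (_ + _)) !dotDl !dotZl.
rewrite !(dotC _ (_ *: _)) !dotZl -!norm2_sqr x1 u1 (dotC u x); lra.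
Qed.

End Euclidean.

(** * Consensus for time-varying stochastic averaging over a strongly connected graph *)

Section StochasticConsensus.
Context {R : realType} {n : nat}.
Variables (E : rel 'I_n) (delta : R).
Hypotheses (E_conn : strongly_connected E).
Hypotheses (delta_gt0 : 0 < delta) (delta_le1 : delta <= 1).

Definition delta_stochastic (w : 'I_n -> 'I_n -> R) :=
  [/\ forall i j, 0 <= w i j, forall i, \sum_j w i j = 1,
      forall i, delta <= w i i & forall i j, E i j -> delta <= w i j].

Definition averaging (w : nat -> 'I_n -> 'I_n -> R) (y : nat -> 'I_n -> R) :=
  (forall t, delta_stochastic (w t)) /\
  forall t i, y t.+1 i = \sum_j w t i j * y t j.

Lemma averaging_opp w y : averaging w y -> averaging w (fun t i => - y t i).
Proof.
move=> [wP yP]; split=> // t i; rewrite yP -sumrN.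
by apply: eq_bigr => j _; rewrite mulrN.
Qed.

Lemma averaging_shift w y s : averaging w y ->
  averaging (fun t => w (s + t)%N) (fun t => y (s + t)%N).
Proof. by move=> [wP yP]; split=> // t i; rewrite addnS. Qed.

(** If [y t j] lies [eta] below the upper bound [M], a weight of at least [delta] on [j] passes a
    fraction [delta] of that gap to [i]; the other terms contribute at most [M] times their
    weights. *)
Lemma averaging_pull w y t i j (M eta : R) : averaging w y -> 0 <= eta ->
  delta <= w t i j -> (forall k, y t k <= M) -> y t j <= M - eta ->
  y t.+1 i <= M - delta * eta.
Proof.
move=> [wP yP] eta0 wij yM yj; have [w0 w1 _ _] := wP t.
have -> : M = \sum_k w t i k * M by rewrite -mulr_suml w1 mul1r.
rewrite yP (bigD1 j)//= [X in X - _](bigD1 j)//= addrAC lerD//; last first.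
  by apply: ler_sum => k _; rewrite ler_wpM2l.
have h1 : w t i j * y t j <= w t i j * (M - eta) by rewrite ler_wpM2l.
have h2 : delta * eta <= w t i j * eta by rewrite ler_wpM2r.
lra.
Qed.

Lemma averaging_ub w y (M : R) : averaging w y -> (forall k, y 0%N k <= M) ->
  forall t k, y t k <= M.
Proof.
move=> wy yM; elim=> [|t ih] k; first exact: yM.
have [wP _] := wy; have [_ _ wd _] := wP t.
have := averaging_pull w y t k k M 0 wy (lexx _) (wd k) ih.
by rewrite mulr0 !subr0; apply.
Qed.

(** Iterates [averaging_pull] along the self-loop at [j]. *)
Lemma averaging_persist w y j (M eta : R) : averaging w y -> 0 <= eta ->
  (forall k, y 0%N k <= M) -> y 0%N j <= M - eta ->
  forall t, y t j <= M - delta ^+ t * eta.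
Proof.
move=> wy eta0 yM yj; elim=> [|t ih]; first by rewrite expr0 mul1r.
have [wP _] := wy; have [_ _ wd _] := wP t.
rewrite exprS -mulrA; apply: (averaging_pull w y t j j M) => //.
- by rewrite mulr_ge0// exprn_ge0// ltW.
- exact: (averaging_ub w).
Qed.

(** An edge from [i] to [j] makes [i] read the value of [j], so the gap travels backwards along the
    path, one edge per time step. *)
Lemma averaging_path w y i p (M eta : R) : averaging w y -> 0 <= eta ->
  path E i p ->
  (forall k, y 0%N k <= M) -> y 0%N (last i p) <= M - eta ->
  y (size p) i <= M - delta ^+ size p * eta.
Proof.
move=> wy eta0 + yM; elim: p i => [|j p ih] i /=; first by rewrite expr0 mul1r.
move=> /andP[Eij pj] yl; have [wP _] := wy; have [_ _ _ wE] := wP (size p).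
rewrite exprS -mulrA.
apply: (averaging_pull w y (size p) i j M); rewrite ?wE ?ih//.
  by rewrite mulr_ge0// exprn_ge0// ltW.
exact: (averaging_ub w).
Qed.

(** The gap at [j] reaches [i] along a simple path, then persists at [i] for the remaining steps;
    the two powers of [delta] multiply to [delta ^+ n] whatever the length of the path. *)
Lemma averaging_low w y j (M eta : R) : averaging w y -> 0 <= eta ->
  (forall k, y 0%N k <= M) -> y 0%N j <= M - eta ->
  forall i, y n i <= M - delta ^+ n * eta.
Proof.
move=> wy eta0 yM yj i.
have /connectP[p0 Ep0 jE] := E_conn i j.
case: (shortenP Ep0) jE => p Ep up _ jE.
(* A duplicate-free path visits at most [n] nodes. *)
have sp : (size p <= n)%N.
  by have := max_card (mem (i :: p)); rewrite card_ord (card_uniqP up) => /ltnW.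
have := averaging_path w y i p M eta wy eta0 Ep yM.
rewrite -jE => /(_ yj) h.
have ws := averaging_shift w y (size p) wy.
have := averaging_persist _ _ i M (delta ^+ size p * eta) ws.
rewrite addn0 => /(_ _ (averaging_ub _ _ _ wy yM _) h (n - size p)%N).
rewrite subnKC// mulrA -exprD subnK//; apply.
by rewrite mulr_ge0// exprn_ge0// ltW.
Qed.

(** Contraction factor of a block of [n] steps: an initial gap of half the spread, of which the
    fraction [delta ^+ n] survives. *)
Let q : R := 1 - delta ^+ n / 2.

(** Any chosen node starts in the lower or the upper half of [[a, b]]; [averaging_low], applied to
    [y] or to [- y], then moves the opposite end of the interval inwards. *)
Lemma averaging_contract w y (a b : R) : averaging w y ->
  (forall k, a <= y 0%N k <= b) ->
  exists a' b', b' - a' = q * (b - a) /\ forall k, a' <= y n k <= b'.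
Proof.
move=> wy yab; have yb k : y 0%N k <= b by case/andP: (yab k).
have ya k : - y 0%N k <= - a by rewrite lerN2; case/andP: (yab k).
have wyN := averaging_opp _ _ wy.
have [[j _]|] := pselect (exists j : 'I_n, True); last first.
  move=> noI; exists 0, (q * (b - a)); rewrite subr0; split=> // k.
  by exfalso; apply: noI; exists k.
have abj := yab j; have ab0 : 0 <= (b - a) / 2 by lra.
have [yj|yj] := leP (y 0%N j) ((a + b) / 2).
  exists a, (b - delta ^+ n * ((b - a) / 2)); split; first by rewrite /q; lra.
  move=> k; apply/andP; split.
    by rewrite -lerN2; apply: (averaging_ub _ _ _ wyN).
  by apply: (averaging_low w y j) => //; lra.
exists (a + delta ^+ n * ((b - a) / 2)), b; split; first by rewrite /q; lra.
move=> k; apply/andP; split; last exact: (averaging_ub _ _ _ wy).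
rewrite -lerN2 opprD; apply: (averaging_low _ _ j _ _ wyN) => //; lra.
Qed.

Lemma averaging_cvg w y : averaging w y ->
  exists l, forall i, y t i @[t --> \oo] --> (l : R).
Proof.
move=> wy.
have [[i0 _]|noI] := pselect (exists j : 'I_n, True); last first.
  by exists 0 => i; exfalso; apply: noI; exists i.
pose a0 := \big[Num.min/y 0%N i0]_i y 0%N i.
pose b0 := \big[Num.max/y 0%N i0]_i y 0%N i.
(* After [s] blocks of [n] steps, one interval of length [q ^+ s * (b0 - a0)] contains all present
   and future values. *)
have step s : exists a b, b - a = q ^+ s * (b0 - a0) /\
    forall t k, a <= y (s * n + t)%N k <= b.
  have ext (z : nat -> 'I_n -> R) v a b : averaging v z ->
      (forall k, a <= z 0%N k <= b) -> forall t k, a <= z t k <= b.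
    move=> vz zab t k; apply/andP; split; last first.
      by apply: (averaging_ub _ _ _ vz) => // k'; case/andP: (zab k').
    rewrite -lerN2; apply: (averaging_ub _ _ _ (averaging_opp _ _ vz)) => k' /=.
    by rewrite lerN2; case/andP: (zab k').
  elim: s => [|s [a [b [abE yab]]]].
    exists a0, b0; rewrite expr0 mul1r mul0n; split=> // t k.
    apply: (ext _ _ _ _ wy) => i; rewrite bigmin_le_cond//=.
    by rewrite (le_bigmax_cond _ (fun i => y 0%N i)).
  have ws := averaging_shift w y (s * n)%N wy.
  have [a' [b' [abE' yab']]] := averaging_contract _ _ a b ws (yab 0%N).
  exists a', b'; split; first by rewrite abE' abE exprS mulrA.
  move=> t k; rewrite mulSn (addnC n).
  apply: (ext _ _ _ _ (averaging_shift _ _ (s * n + n)%N wy)) => i.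
  by rewrite addn0.
have dn0 : 0 < delta ^+ n by rewrite exprn_gt0.
have dn1 : delta ^+ n <= 1 by rewrite exprn_ile1// ltW.
have q1 : `|q| < 1 by rewrite /q ger0_norm; lra.
have qcvg : q ^+ s * (b0 - a0) @[s --> \oo] --> (0 : R).
  by rewrite -[X in _ --> X](mul0r (b0 - a0)); apply: cvgMl; exact: cvg_expr.
(* Uniformity in both times and both nodes serves twice: it makes the values at [i0] Cauchy, and it
   sends the differences between nodes to 0. *)
have close e : 0 < e -> exists T, forall t t' i i', (T <= t)%N -> (T <= t')%N ->
    `|y t i - y t' i'| < e.
  move=> e0; move/cvgr0_norm_lt : qcvg => /(_ e e0)[s _ /(_ s (leqnn s)) qe].
  have [a [b [abE yab]]] := step s.
  exists (s * n)%N => t t' i i' /subnKC <- /subnKC <-.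
  rewrite (le_lt_trans _ qe)// -abE (le_trans _ (ler_norm _))//.
  have := yab (t - s * n)%N i; have := yab (t' - s * n)%N i'.
  rewrite ler_norml; lra.
have cv : cvg (y t i0 @[t --> \oo]).
  apply/cauchy_cvgP/cauchy_exP => e e0; have [T HT] := close e e0.
  exists (y T i0); exists T => // t /= Tt; exact: HT.
have /cvg_ex[l il] := cv.
exists l => i.
rewrite (_ : (fun t => y t i) = (fun t => y t i0 + (y t i - y t i0))).
  rewrite -[X in _ --> X]addr0; apply: cvgD => //.
  apply/cvgr0Pnorm_lt => e e0; have [T HT] := close e e0.
  by exists T => // t /= Tt; exact: HT.
by apply/funext => t; rewrite addrC subrK.
Qed.

End StochasticConsensus.

(** * Convergence of matrices and directions, and extrema on the sphere *)

Section Topology.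
Context {R : realType}.

Lemma cvg_mx {T : Type} {F : set_system T} {FF : Filter F} {m n : nat}
    (f : T -> 'M[R]_(m, n)) (M : 'M[R]_(m, n)) :
  (forall i j, f t i j @[t --> F] --> M i j) -> f t @[t --> F] --> M.
Proof.
move=> fM A [P M_P PA]; apply: (@filterS _ F _ _ _ (fun t => PA (f t))).
by apply: filter_forall => i; apply: filter_forall => j; exact: fM (M_P i j).
Qed.

Lemma cvg_coord {T : Type} {F : set_system T} {FF : Filter F} {m n : nat}
    (f : T -> 'M[R]_(m, n)) (M : 'M[R]_(m, n)) i j :
  f t @[t --> F] --> M -> f t i j @[t --> F] --> M i j.
Proof.
by move=> fM; apply: (cvg_comp f (fun N => N i j) fM); exact: coord_continuous.
Qed.

Lemma cvg_sumr {T : Type} {F : set_system T} {FF : Filter F} {I : finType}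
    (f : I -> T -> R) (l : I -> R) :
  (forall i, f i t @[t --> F] --> l i) ->
  \sum_i f i t @[t --> F] --> \sum_i l i.
Proof.
by move=> fl; apply: (@cvg_big R I +%R 0 xpredT) => // x; exact: add_continuous.
Qed.

Lemma cvg_dot {T : Type} {F : set_system T} {FF : Filter F} {d : nat}
    (f : T -> 'rV[R]_d) (x u : 'rV[R]_d) :
  f t @[t --> F] --> x -> dot (f t) u @[t --> F] --> dot x u.
Proof.
by move=> fx; apply: cvg_sumr => j; apply: cvgMl; exact: cvg_coord.
Qed.

Lemma norm2_continuous {d : nat} : continuous (@norm2 R d).
Proof.
move=> x; apply: (@cvg_comp _ _ _ _ Num.sqrt); last exact: sqrt_continuous.
apply: (@cvg_sumr _ (nbhs x) _ _ (fun j y => y 0 j ^+ 2)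
  (fun j => x 0 j ^+ 2)) => j.
rewrite expr2; under eq_fun do rewrite expr2.
by apply: cvgM; exact: coord_continuous.
Qed.

Lemma unitdir_continuous {d : nat} (x : 'rV[R]_d) :
  x != 0 -> {for x, continuous unitdir}.
Proof.
move=> x0.
apply: (@cvgZ _ _ _ (nbhs x) _ (fun y => (norm2 y)^-1) id); last exact: cvg_id.
apply: (@cvgV _ _ (nbhs x) _ norm2); last exact: norm2_continuous.
by rewrite gt_eqF// norm2_neq0.
Qed.

(** Links convergence in the Euclidean norm to the library topology, which comes from the maximum
    norm: each coordinate is dominated by [norm2], and [norm2] is continuous. *)
Lemma cvg_norm2 {T : Type} {F : set_system T} {FF : Filter F} {d : nat}
    (f : T -> 'rV[R]_d) (x : 'rV[R]_d) :
  (f t @[t --> F] --> x) <-> (norm2 (f t - x) @[t --> F] --> (0 : R)).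
Proof.
split=> fx; last first.
  apply: cvg_mx => i j; rewrite (ord1 i); apply/cvgrPdist_lt => e e0.
  move/cvgr0Pnorm_lt : fx => /(_ e e0); apply: filterS => t.
  rewrite ger0_norm ?norm2_ge0//; apply: le_lt_trans.
  have -> : x 0 j - f t 0 j = - (f t - x) 0 j by rewrite !mxE opprB.
  by rewrite normrN; exact: normr_coord_le.
rewrite -(@norm20 R d) -(subrr x).
apply: (@cvg_comp _ _ _ _ (@norm2 R d)); last exact: norm2_continuous.
by apply: cvgB => //; exact: cvg_cst.
Qed.

Lemma sphere2_compact {d : nat} : compact (@sphere2 R d).
Proof.
apply: bounded_closed_compact.
  exists 1; split; first exact: num_real.
  move=> M M1 x /= x1; rewrite [leLHS]/Num.Def.normr /= mx_normrE bigmax_le//.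
    by rewrite (le_trans ler01)// ltW.
  move=> [i j] _ /=; rewrite (ord1 i) (le_trans (normr_coord_le x j))//.
  by rewrite x1 ltW.
rewrite (_ : sphere2 d = norm2 @^-1` [set 1])//.
by apply: preimage_closed => [x _|]; [exact: norm2_continuous|exact: closed_eq].
Qed.

Lemma sphere2_nonempty {d : nat} : (0 < d)%N -> @sphere2 R d !=set0.
Proof.
move=> d0; exists (unitdir (delta_mx 0 (Ordinal d0))).
apply: norm2_unitdir; apply/eqP => /rowP/(_ (Ordinal d0)).
by rewrite !mxE !eqxx => /eqP; rewrite oner_eq0.
Qed.

(** The extreme value theorem on the compact nonempty sphere shows that the minimum is attained, so
    [get] returns it; as a value of [g], it is positive. *)
Lemma set_min_directional {d : nat} (g : 'rV[R]_d -> R) : (0 < d)%N ->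
  directional g ->
  0 < set_min (g @` sphere2 d) /\
  forall x, sphere2 d x -> set_min (g @` sphere2 d) <= g x.
Proof.
move=> d0 [gc [a [b [a0 _ gab]]]].
have [c cS cmin] := EVT_min_rV (sphere2_nonempty d0) sphere2_compact gc.
have : exists m, (g @` sphere2 d `&` lbound (g @` sphere2 d)) m.
  exists (g c); split; first by exists c => //; rewrite inE in cS.
  by move=> _ [x xS <-]; apply: cmin; rewrite inE.
move=> /getPex; rewrite -/(set_min _) => -[[x xS <-] lb]; split.
  by have /andP[+ _] := gab x xS; exact: lt_le_trans.
by move=> y yS; apply: lb; exists y.
Qed.

Lemma set_max_directional {d : nat} (g : 'rV[R]_d -> R) : (0 < d)%N ->
  directional g -> forall x, sphere2 d x -> g x <= set_max (g @` sphere2 d).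
Proof.
move=> d0 [gc _].
have [c cS cmax] := EVT_max_rV (sphere2_nonempty d0) sphere2_compact gc.
have : exists m, (g @` sphere2 d `&` ubound (g @` sphere2 d)) m.
  exists (g c); split; first by exists c => //; rewrite inE in cS.
  by move=> _ [x xS <-]; apply: cmax; rewrite inE.
by move=> /getPex; rewrite -/(set_max _) => -[_ ub] x xS; apply: ub; exists x.
Qed.

End Topology.

(** Continuity of [g] is known only within the sphere, so the approximating points must eventually
    lie on it. *)
Lemma directional_cvg {R : realType} {d : nat} (g : 'rV[R]_d -> R) {T : Type}
    {F : set_system T} {FF : Filter F} (f : T -> 'rV[R]_d) (y : 'rV[R]_d) :
  directional g -> sphere2 d y -> (\forall t \near F, sphere2 d (f t)) ->
  f t @[t --> F] --> y -> g (f t) @[t --> F] --> g y.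
Proof.
move=> [/subspace_continuousP gc _] ys fs fy.
apply: (@cvg_comp _ _ _ f g F (within (sphere2 d) (nbhs y))); last exact: gc.
move=> P wP; apply: filterS2 fs (fy _ wP) => t ft; exact.
Qed.

(** * The iteration, with [lo] and [hi] standing for bounds on the directional functions *)

Section Dynamics.
Context {R : realType} {n d : nat}.
Variables (gamma : 'I_n -> 'rV[R]_d -> R) (E : rel 'I_n) (A : 'M[R]_n).
Variables (lo hi : 'I_n -> R).
Hypotheses (n_gt0 : (0 < n)%N) (gamma_dir : forall i, directional (gamma i)).
Hypotheses (E_conn : strongly_connected E) (A_weight : weight_matrix E A).
Hypotheses (lo_gt0 : forall i, 0 < lo i) (hi_gt0 : forall i, 0 < hi i).
Hypotheses (gamma_lo : forall i x, sphere2 d x -> lo i <= gamma i x).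
Hypotheses (gamma_hi : forall i x, sphere2 d x -> gamma i x <= hi i).
Hypothesis A_dom :
  forall i, \sum_(j < n | j != i) A i j * hi j < A i i * lo i.

Let S := star_product gamma.
Let step (X : 'M[R]_(n, d)) := radial_proj gamma (A *m X).

Let A_ge0 i j : 0 <= A i j.
Proof.
have [Apos A0] := A_weight i j; case: (boolP (E i j)) => Eij.
  by rewrite ltW// Apos.
by rewrite A0.
Qed.

(** The left-hand side of [A_dom] is nonnegative. This provides the self-loops of the averaging. *)
Let A_diag_gt0 i : 0 < A i i.
Proof.
rewrite -(pmulr_lgt0 _ (lo_gt0 i)) (le_lt_trans _ (A_dom i))// sumr_ge0//.
by move=> j _; rewrite mulr_ge0// ltW.
Qed.

Lemma star_productP X i : S X ->
  [/\ row i X != 0, lo i <= norm2 (row i X) <= hi i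
    & row i X = gamma i (unitdir (row i X)) *: unitdir (row i X)].
Proof.
move=> /(_ i)[x xs <-].
have g0 : 0 < gamma i x by rewrite (lt_le_trans (lo_gt0 i))// gamma_lo.
rewrite unitdirZ// unitdir_id// norm2Z xs mulr1 gtr0_norm//.
rewrite gamma_lo// gamma_hi//.
by rewrite scaler_eq0 negb_or gt_eqF// sphere2_neq0.
Qed.

Lemma row_mulmx_sum (X : 'M[R]_(n, d)) i :
  row i (A *m X) = \sum_j A i j *: row j X.
Proof.
by rewrite row_mul mulmx_sum_row; apply: eq_bigr => j _; rewrite mxE.
Qed.

(** If the row vanished, the diagonal term, of norm at least [A i i * lo i], would be cancelled by
    terms of total norm at most the left-hand side of [A_dom]. *)
Lemma row_mulmx_neq0 X i : S X -> row i (A *m X) != 0.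
Proof.
move=> XS; rewrite row_mulmx_sum (bigD1 i)//=.
set s := \sum_(j | _) _; apply/eqP => h.
have : norm2 (A i i *: row i X) = norm2 s.
  by rewrite -norm2N; congr norm2; apply/eqP; rewrite eq_sym -addr_eq0 addrC h.
apply/eqP; rewrite gt_eqF//.
have [_ /andP[lX _] _] := star_productP _ i XS.
rewrite norm2Z ger0_norm//.
apply: (@lt_le_trans _ _ (A i i * lo i)); last by rewrite ler_wpM2l.
apply: le_lt_trans (A_dom i); apply: (le_trans (norm2_sum _ _ _)).
apply: ler_sum => j _; have [_ /andP[_ hX] _] := star_productP _ j XS.
by rewrite norm2Z ger0_norm// ler_wpM2l.
Qed.

Lemma row_step X i : row i (step X) =
  gamma i (unitdir (row i (A *m X))) *: unitdir (row i (A *m X)).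
Proof. by rewrite rowK. Qed.

(** Hides [gamma] in a positive scalar; cap invariance and averaging are insensitive to it. *)
Lemma row_step_scale X i : S X ->
  exists s, 0 < s /\ row i (step X) = s *: \sum_j A i j *: row j X.
Proof.
move=> XS; have h0 := row_mulmx_neq0 X i XS.
rewrite row_step -row_mulmx_sum; set y := row i _ in h0 *.
exists (gamma i (unitdir y) * (norm2 y)^-1); rewrite -scalerA; split=> //.
rewrite mulr_gt0 ?invr_gt0 ?norm2_neq0//.
by rewrite (lt_le_trans (lo_gt0 i))// gamma_lo//; exact: norm2_unitdir.
Qed.

Lemma step_star X : S X -> S (step X).
Proof.
move=> XS i; rewrite row_step; eexists; last by [].
by apply: norm2_unitdir; exact: row_mulmx_neq0.
Qed.

Lemma iter_step_star X k : S X -> S (iter k step X).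
Proof. by move=> XS; elim: k => //= k; exact: step_star. Qed.

Lemma cvg_unitdir_row {T : Type} {F : set_system T} {FF : Filter F}
    (f : T -> 'M[R]_(n, d)) X i : row i X != 0 ->
  f t @[t --> F] --> X ->
  unitdir (row i (f t)) @[t --> F] --> unitdir (row i X).
Proof.
move=> X0 fX; apply: (cvg_comp (fun t => row i (f t)) unitdir); last first.
  exact: (unitdir_continuous _ X0).
apply: cvg_mx => a j; rewrite mxE; under eq_fun do rewrite mxE.
exact: cvg_coord.
Qed.

Lemma cvg_step {T : Type} {F : set_system T} {FF : Filter F}
    (f : T -> 'M[R]_(n, d)) X : S X -> (\forall t \near F, S (f t)) ->
  f t @[t --> F] --> X -> step (f t) @[t --> F] --> step X.
Proof.
move=> XS fS fX.
have mX : A *m f t @[t --> F] --> A *m X.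
  apply: cvg_mx => i j; rewrite mxE; under eq_fun do rewrite mxE.
  by apply: cvg_sumr => k; apply: cvgMr; exact: cvg_coord.
apply: cvg_mx => i j.
have -> : step X i j = row i (step X) 0 j by rewrite [RHS]mxE.
have -> : (fun t => step (f t) i j) = (fun t => row i (step (f t)) 0 j).
  by apply/funext => t; rewrite [RHS]mxE.
apply: cvg_coord; rewrite row_step; under eq_fun do rewrite row_step.
have uX : unitdir (row i (A *m f t)) @[t --> F] --> unitdir (row i (A *m X)).
  exact: cvg_unitdir_row (row_mulmx_neq0 _ i XS) mX.
have us Z : S Z -> sphere2 d (unitdir (row i (A *m Z))).
  by move=> ZS; apply: norm2_unitdir; exact: row_mulmx_neq0.
have usF : \forall t \near F, sphere2 d (unitdir (row i (A *m f t))).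
  by apply: filterS fS => t; exact: us.
exact: cvgZ (directional_cvg _ _ _ (gamma_dir i) (us X XS) usF uX) uX.
Qed.

Lemma cvg_iter_step X k : S X ->
  iter k step Z @[Z --> within S (nbhs X)] --> iter k step X.
Proof.
move=> XS; elim: k => [|k ih] /=; first exact: cvg_within.
apply: cvg_step => //; first exact: iter_step_star.
by rewrite near_withinE; apply: nearW => Z; exact: iter_step_star.
Qed.

(** For a unit [u], the cone of vectors whose angle with [u] has cosine at least [c], written
    without division so that its convexity is the triangle inequality. *)
Definition in_cap (u : 'rV[R]_d) (c : R) (X : 'M[R]_(n, d)) :=
  forall i, c * norm2 (row i X) <= dot (row i X) u.

Lemma in_cap_step u c X : 0 <= c -> S X -> in_cap u c X -> in_cap u c (step X).
Proof.
move=> c0 XS Xu i; have [s [s0 ->]] := row_step_scale _ i XS.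
rewrite norm2Z gtr0_norm// dotZl mulrCA ler_pM2l// dot_suml.
apply: (@le_trans _ _ (\sum_j c * norm2 (A i j *: row j X))).
  by rewrite -mulr_sumr ler_wpM2l// norm2_sum.
apply: ler_sum => j _; rewrite norm2Z dotZl ger0_norm// mulrCA.
by rewrite ler_wpM2l.
Qed.

(* The central projections [row i X / dot (row i X) u] onto the affine
   hyperplane [dot _ u = 1] evolve by averaging; the radial functions only
   enter through the weights. *)
Lemma in_cap_consensus u c X : 0 < c -> norm2 u = 1 -> S X -> in_cap u c X ->
  exists v, [/\ sphere2 d v, c <= dot v u &
    forall i, unitdir (row i (iter t step X)) @[t --> \oo] --> v].
Proof.
move=> c0 u1 XS Xu.
pose Z t := iter t step X.
have ZS t : S (Z t) := iter_step_star X t XS.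
have Zu t : in_cap u c (Z t).
  by elim: t => // t ih; apply: in_cap_step => //; exact: ltW.
(* The cap keeps these heights between [c * lo i] and [hi i] at all times, which makes the weights
   below uniformly bounded. *)
pose h t i := dot (row i (Z t)) u.
have h_lo t i : c * lo i <= h t i.
  have [_ /andP[l _] _] := star_productP _ i (ZS t).
  by apply: le_trans (Zu t i); rewrite ler_pM2l.
have h_hi t i : h t i <= hi i.
  have [_ /andP[_ l] _] := star_productP _ i (ZS t).
  by apply: le_trans l; rewrite (le_trans (dot_le_norm2 _ _))// u1 mulr1.
have h_gt0 t i : 0 < h t i by rewrite (lt_le_trans _ (h_lo t i))// mulr_gt0.
pose H t i := \sum_j A i j * h t j.
have H_gt0 t i : 0 < H t i.
  rewrite /H (bigD1 i)//= ltr_pwDl ?mulr_gt0// sumr_ge0// => j _.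
  by rewrite mulr_ge0// ltW.
pose G i := \sum_j A i j * hi j.
have H_le t i : H t i <= G i by apply: ler_sum => j _; rewrite ler_wpM2l.
have G_gt0 i : 0 < G i := lt_le_trans (H_gt0 0%N i) (H_le 0%N i).
(* Substituting [row j (Z t) = h t j *: Y t j] in the weighted sum and dividing by its height
   [H t i] gives these coefficients. *)
pose w t i j := A i j * h t j / H t i.
(* Heights are bounded below in the numerator and above in the denominator; the default value 1
   ensures [delta <= 1]. *)
pose delta := \big[Num.min/1]_(ij | 0 < A ij.1 ij.2)
  (A ij.1 ij.2 * (c * lo ij.2) / G ij.1).
have delta_gt0 : 0 < delta.
  apply/bigmin_gtP; split=> // -[i j] /= Aij.
  by rewrite !mulr_gt0// invr_gt0.
have delta_le1 : delta <= 1 by exact: bigmin_le_id.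
have delta_w t i j : 0 < A i j -> delta <= w t i j.
  move=> Aij; apply: (@le_trans _ _ (A i j * (c * lo j) / G i)).
    exact: (bigmin_le_cond _ (fun ij => A ij.1 ij.2 * (c * lo ij.2) / G ij.1)
      (j := (i, j))).
  apply: ler_pM; last by rewrite lef_pV2 ?posrE.
  - by rewrite !mulr_ge0// ltW.
  - by rewrite invr_ge0 ltW.
  - by rewrite ler_wpM2l.
have w_stoch t : delta_stochastic E delta (w t).
  split=> [i j|i|i|i j Eij].
  - by rewrite /w !mulr_ge0 ?invr_ge0// ltW.
  - rewrite -(@divff _ (H t i)) ?gt_eqF//.
    by rewrite /H mulr_suml.
  - exact: delta_w.
  - by apply: delta_w; have [+ _] := A_weight i j; exact.
pose Y t i := (h t i)^-1 *: row i (Z t).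
have Y_avg k : averaging E delta w (fun t i => Y t i 0 k).
  split=> // t i; have [s [s0 rE]] := row_step_scale _ i (ZS t).
  rewrite /Y /h /= -/(Z t) rE dotZl dot_suml.
  have -> : \sum_j dot (A i j *: row j (Z t)) u = H t i.
    by apply: eq_bigr => j _; rewrite dotZl.
  (* The scalar [s] cancels between the row and its height. *)
  rewrite scalerA invfM mulrAC mulVf ?gt_eqF// mul1r mxE summxE mulr_sumr.
  apply: eq_bigr => j _; rewrite /w !mxE.
  have := h_gt0 t j; rewrite /h => h0; field.
  by rewrite !gt_eqF.
have /choice[l lP] k :=
  averaging_cvg E delta E_conn delta_gt0 delta_le1 w _ (Y_avg k).
pose y : 'rV[R]_d := \row_k l k.
have Yy i : Y t i @[t --> \oo] --> y.
  by apply: cvg_mx => a k; rewrite (ord1 a) mxE; exact: lP.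
have i0 : 'I_n := Ordinal n_gt0.
(* The limit inherits height 1, so it is nonzero and has a direction. *)
have Y1 t i : dot (Y t i) u = 1 by rewrite dotZl mulVf// gt_eqF.
have y1 : dot y u = 1.
  have : dot (Y t i0) u @[t --> \oo] --> dot y u by exact: cvg_dot.
  under eq_fun do rewrite Y1.
  by move=> /(cvg_lim (@norm_hausdorff _ _)) <-; rewrite lim_cst.
have y0 : y != 0.
  apply/eqP => yE; move: y1; rewrite yE /dot big1 => [/eqP|j _].
    by rewrite eq_sym oner_eq0.
  by rewrite mxE mul0r.
exists (unitdir y); split.
- exact: norm2_unitdir.
- rewrite dotZl y1 mulr1.
  (* The cap inequality for [Y t i0], of height 1, passes to the limit. *)
  have cy : c * norm2 y <= 1.
    have nY : c * norm2 (Y t i0) @[t --> \oo] --> c * norm2 y.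
      apply: cvgMr; apply: (cvg_comp (fun t => Y t i0) norm2 (Yy i0)).
      exact: norm2_continuous.
    rewrite -(cvg_lim _ nY)//; apply: limr_le.
      by apply/cvg_ex; eexists; exact: nY.
    apply: nearW => t; rewrite -(Y1 t i0) dotZl norm2Z gtr0_norm ?invr_gt0//.
    by rewrite mulrCA ler_pM2l ?invr_gt0//; exact: Zu.
  by rewrite -(ler_pM2r (norm2_neq0 y y0)) mulVf// gt_eqF// norm2_neq0.
(* Positive rescaling preserves directions, so those of [Y] replace those of the trajectory. *)
- move=> i; under eq_fun => t.
    rewrite -(unitdirZ (h t i)^-1); last by rewrite invr_gt0.
    over.
  apply: (cvg_comp (fun t => Y t i) unitdir (Yy i)).
  exact: (unitdir_continuous _ y0).
Qed.

(** * Perturbation of consensus trajectories, openness and continuity *)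

Section Trajectory.
Variable t0 : nat.

Lemma consensus_directionP X u : is_consensus_direction A gamma t0 X u <->
  sphere2 d u /\
  forall i, unitdir (row i (trajectory A gamma t0 X t)) @[t --> \oo] --> u.
Proof. by split=> -[us uP]; split=> // i; apply/cvg_norm2; exact: uP. Qed.

Lemma consensus_direction_unique X u v :
  is_consensus_direction A gamma t0 X u ->
  is_consensus_direction A gamma t0 X v -> u = v.
Proof.
move=> /consensus_directionP[_ uP] /consensus_directionP[_ vP].
(* A row exists because [n] is positive; with no rows, every unit vector would qualify. *)
rewrite -(cvg_lim (@norm_hausdorff _ _) (uP (Ordinal n_gt0))).
by rewrite -(cvg_lim (@norm_hausdorff _ _) (vP (Ordinal n_gt0))).
Qed.

Lemma near_consensus X u c : 0 < c < 1 -> S X ->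
  is_consensus_direction A gamma t0 X u ->
  \forall X' \near within S (nbhs X),
    exists v, is_consensus_direction A gamma t0 X' v /\ c <= dot v u.
Proof.
move=> /andP[c0 c1] XS /consensus_directionP[us uP].
(* The cosines tend to [dot u u = 1 > c], so the cap inequality is eventually strict, hence stable
   under perturbation. *)
have : \forall t \near \oo, forall i,
    c < dot (unitdir (row i (trajectory A gamma t0 X t))) u.
  apply: filter_forall => i; apply: cvgr_gt (cvg_dot _ _ u (uP i)) _ _.
  by rewrite -norm2_sqr us expr1n.
move=> [T _ /(_ T (leqnn T)) /=]; rewrite /trajectory.
(* If [T < t0], truncated subtraction gives [k = 0], in agreement with [trajectory]. *)
set k := (T - t0)%N => Xc.
have kS : S (iter k step X) by exact: iter_step_star.
have : \forall X' \near within S (nbhs X), forall i,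
    c < dot (unitdir (row i (iter k step X'))) u.
  apply: filter_forall => i; apply: cvgr_gt (Xc i).
  apply: cvg_dot; apply: cvg_unitdir_row; last exact: cvg_iter_step.
  by have [] := star_productP _ i kS.
have : \forall X' \near within S (nbhs X), S (iter k step X').
  by rewrite near_withinE; apply: nearW => Z; exact: iter_step_star.
apply: filterS2 => X' X'S X'c.
have X'u : in_cap u c (iter k step X').
  move=> i; have [r0 _ _] := star_productP _ i X'S.
  move: (ltW (X'c i)); rewrite dotZl mulrC ler_pdivlMr// norm2_neq0//.
have [v [vs vc vP]] := in_cap_consensus u c _ c0 us X'S X'u.
exists v; split=> //; apply/consensus_directionP; split=> // i.
(* The limit was found for the iteration restarted after [k] steps; from time [t0 + k] on it is the
   trajectory of [X'] up to a time shift. *)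
have := cvg_comp _ _ (cvg_subnr (t0 + k)) (vP i).
apply: cvg_trans; apply: near_eq_cvg; exists (t0 + k)%N => // t /= tk.
rewrite /trajectory -iterD; congr (unitdir (row i (iter _ _ _))).
by rewrite subnDA subnK// leq_subRL// (leq_trans _ tk)// leq_addr.
Qed.

Let U := consensus_set A gamma t0.
Let dir := consensus_direction A gamma t0.

Lemma dirP X : U X -> is_consensus_direction A gamma t0 X (dir X).
Proof. by move=> [_ /getPex]. Qed.

Lemma consensus_set_open : open (U : set (subspace S)).
Proof.
suff UX (X : 'M[R]_(n, d)) : U X -> within S (nbhs X) U.
  move=> X XU; rewrite /interior /=.
  by have := UX X XU; rewrite (@nbhs_subspace_in 'M[R]_(n, d) S X (proj1 XU)).
move=> [XS [u uP]].
(* Openness needs only one cap, of any aperture with [0 < c < 1]. *)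
have c01 : 0 < (2^-1 : R) < 1 by lra.
have := near_consensus X u _ c01 XS uP.
rewrite near_withinE; apply: filterS => X' h X'S; split=> //.
by have [v [vP _]] := h X'S; exists v.
Qed.

Lemma dir_cvg X : U X -> dir Z @[Z --> within U (nbhs X)] --> dir X.
Proof.
move=> XU; have [us _] := dirP X XU; apply/cvg_norm2/cvgr0Pnorm_lt => e e0.
(* A cosine of at least [1 - e ^+ 2 / 4] bounds the squared distance by [e ^+ 2 / 2]; the maximum
   with one half keeps [c] positive for large [e]. *)
pose c := Num.max 2^-1 (1 - e ^+ 2 / 4).
have e20 : 0 < e ^+ 2 by rewrite exprn_gt0.
have c01 : 0 < c < 1 by rewrite /c lt_max gt_max; lra.
have ce : 1 - e ^+ 2 / 4 <= c by rewrite /c le_max lexx orbT.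
have := near_consensus X _ c c01 (proj1 XU) (dirP X XU).
rewrite !near_withinE; apply: filterS => X' h X'U.
have [v [vP vc]] := h (proj1 X'U).
have -> : dir X' = v by exact: consensus_direction_unique (dirP X' X'U) vP.
rewrite ger0_norm ?norm2_ge0// -ltr_sqr ?nnegrE ?norm2_ge0 ?ltW//.
rewrite norm2_sub_sqr//; last by case: vP.
lra.
Qed.

Hypothesis gamma_eq : forall i j x, sphere2 d x -> gamma i x = gamma j x.
Let g := gamma (Ordinal n_gt0).

(** Each row is [gamma i] of its direction times that direction; both factors converge, and the
    functions [gamma i] agree at the limit. *)
Lemma dir_consensus_state X : U X ->
  is_consensus_state A gamma t0 X (g (dir X) *: dir X).
Proof.
move=> XU i; have XS := proj1 XU.
have /consensus_directionP[us uP] := dirP X XU.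
have rP t := star_productP _ i (iter_step_star X (t - t0) XS).
under eq_fun => t do [have [_ _ ->] := rP t].
have uS : \forall t \near \oo,
    sphere2 d (unitdir (row i (trajectory A gamma t0 X t))).
  by apply: nearW => t; have [r0 _ _] := rP t; exact: norm2_unitdir.
rewrite /g -(gamma_eq i)//.
exact: cvgZ (directional_cvg _ _ _ (gamma_dir i) us uS (uP i)) (uP i).
Qed.

Lemma consensus_stateE X : U X ->
  consensus_state A gamma t0 X = g (dir X) *: dir X.
Proof.
move=> XU; apply: get_unique; first exact: dir_consensus_state.
move=> y yP; have sP := dir_consensus_state X XU (Ordinal n_gt0).
rewrite -(cvg_lim (@norm_hausdorff _ _) sP).
by rewrite -(cvg_lim (@norm_hausdorff _ _) (yP (Ordinal n_gt0))).
Qed.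

(** On [U] the state is [g (dir Z) *: dir Z], so its continuity follows from that of the
    direction. *)
Lemma consensus_state_cvg X : U X ->
  consensus_state A gamma t0 Z @[Z --> within U (nbhs X)] -->
  consensus_state A gamma t0 X.
Proof.
move=> XU; rewrite consensus_stateE//.
have dU : \forall Z \near within U (nbhs X), sphere2 d (dir Z).
  by rewrite near_withinE; apply: nearW => Z ZU; have [] := dirP Z ZU.
have dc := dir_cvg X XU; have [us _] := dirP X XU.
have : g (dir Z) *: dir Z @[Z --> within U (nbhs X)] --> g (dir X) *: dir X.
  exact: cvgZ (directional_cvg _ _ _ (gamma_dir _) us dU dc) dc.
apply: cvg_trans; apply: near_eq_cvg; rewrite near_withinE.
by apply: nearW => Z ZU; rewrite consensus_stateE.
Qed.

End Trajectory.
End Dynamics.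

(** * Assembly, with the extrema of the directional functions as bounds *)

Theorem corollary1 (R : realType) (n d : nat) (n_gt0 : (0 < n)%N)
    (d_gt0 : (0 < d)%N) (gamma : 'I_n -> 'rV[R]_d -> R)
    (gamma_dir : forall i, directional (gamma i))
    (E : rel 'I_n) (A : 'M[R]_n)
    (E_conn : strongly_connected E) (A_weight : weight_matrix E A)
    (A_dom : forall i : 'I_n,
      \sum_(j < n | j != i) A i j * set_max (gamma j @` sphere2 d)
        < A i i * set_min (gamma i @` sphere2 d))
    (t0 : nat) :
  [/\ open (consensus_set A gamma t0 : set (subspace (star_product gamma))),
      {within consensus_set A gamma t0,
         continuous (consensus_direction A gamma t0)}
    & (forall i j x, sphere2 d x -> gamma i x = gamma j x) ->
      (forall X0, consensus_set A gamma t0 X0 ->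
         is_consensus_state A gamma t0 X0 (consensus_state A gamma t0 X0)) /\
      {within consensus_set A gamma t0,
         continuous (consensus_state A gamma t0)}].
Proof.
pose lo i := set_min (gamma i @` sphere2 d).
pose hi i := set_max (gamma i @` sphere2 d).
have lo0 i : 0 < lo i by have [] := set_min_directional _ d_gt0 (gamma_dir i).
have glo i x : sphere2 d x -> lo i <= gamma i x.
  by have [_ +] := set_min_directional _ d_gt0 (gamma_dir i); exact.
have ghi i := set_max_directional _ d_gt0 (gamma_dir i).
have hi0 i : 0 < hi i.
  have [x xs] := @sphere2_nonempty R d d_gt0.
  exact: lt_le_trans (lo0 i) (le_trans (glo i x xs) (ghi i x xs)).
split.
- exact: (consensus_set_open gamma E A lo hi).
- by apply/subspace_continuousP; exact: (dir_cvg gamma E A lo hi).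
- move=> geq; split.
    move=> X XU; rewrite (consensus_stateE gamma E A lo hi n_gt0)//.
    exact: (dir_consensus_state gamma E A lo hi).
  apply/subspace_continuousP.
  exact: (consensus_state_cvg gamma E A lo hi n_gt0).
Qed.
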